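(* Let $Q=\langle X\mid R\rangle$ be a finitely presented group (with $X$ and $R$ finite), let $R_1$ be a subset of $R$, and let $G=\langle X\mid R_1\rangle$, so that there is a natural surjection $G\to Q$. Let $\chi$ be a character of $Q$, and denote the character of $G$ induced by $\chi$ (by composing with $G\to Q$) by the same symbol. Suppose that (a) $[\chi]\in\Sigma^2(G)$, and (b) for every $r\in R\setminus R_1$ there exists $g_r\in G$ with $\chi(g_r)\neq 0$ such that $g_r$ commutes with the image of $r$ in $G$. Then $[\chi]\in\Sigma^2(Q)$.
   Context: A character of a group $G$ is a homomorphism $\chi\colon G\to\mathbb{R}$. Two non-zero characters are equivalent if they differ by multiplication by a positive scalar; the classes $[\chi]$ of non-zero characters form the character sphere $\mathbb{S}(G)$. The invariant $\Sigma^2$. Let $G$ be a finitely presented group, and let $Y$ be the Cayley complex of $G$ with respect to a finite presentation (equivalently, the $2$-skeleton of the universal cover of a classifying space for $G$ with finite $2$-skeleton), with its $G$-action. For a non-zero character $\chi$ there is a continuous map $h_\chi\colon Y\to\mathbb{R}$ with $h_\chi(g.y)=\chi(g)+h_\chi(y)$ for all $g\in G$, $y\in Y$. For $t\in\mathbb{R}$ let $Y^{h_\chi\ge t}$ be the subcomplex of all cells of $Y$ whose vertices lie in $h_\chi^{-1}([t,\infty))$. Then $\Sigma^2(G)\subseteq\mathbb{S}(G)$ is the set of $[\chi]$ such that for every $t$ there exists $u\le t$ for which the inclusion $Y^{h_\chi\ge t}\to Y^{h_\chi\ge u}$ induces the trivial map on $\pi_0$ and $\pi_1$. This does not depend on the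 choices made. *)

(* Defs.v *)
From HB Require Import structures.
From mathcomp Require Import all_boot all_order all_algebra.
From mathcomp Require Import boolp classical_sets reals.

Set Implicit Arguments.
Unset Strict Implicit.
Unset Printing Implicit Defensive.

Import Order.TTheory GRing.Theory Num.Theory.

Local Open Scope classical_set_scope.
Local Open Scope quotient_scope.

(* [(x, false)] is the letter x and [(x, true)] is its formal inverse. Words
   are not required to be reduced. *)
Notation letter X := (X * bool)%type.
Notation word X := (seq (X * bool)).

Definition invl (X : Type) (a : letter X) : letter X := (a.1, ~~ a.2).
Definition invw (X : Type) (w : word X) : word X := rev (map (@invl X) w).

(* Equality of words in <X | rels>: the congruence on words generated by
   a a^-1 = 1 for all letters a, and r = 1 for all r in rels. *)
Inductive word_eq (X : choiceType) (rels : seq (word X)) :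
    word X -> word X -> Prop :=
| word_eq_refl w : word_eq rels w w
| word_eq_sym w1 w2 : word_eq rels w1 w2 -> word_eq rels w2 w1
| word_eq_trans w1 w2 w3 :
    word_eq rels w1 w2 -> word_eq rels w2 w3 -> word_eq rels w1 w3
| word_eq_cancel w1 a w2 :
    word_eq rels (w1 ++ w2) (w1 ++ [:: a; invl a] ++ w2)
| word_eq_relator w1 r w2 : r \in rels ->
    word_eq rels (w1 ++ w2) (w1 ++ r ++ w2).

Section Presented.
Variables (X : choiceType) (rels : seq (word X)).

Definition word_eqb : rel (word X) := fun w1 w2 => `[< word_eq rels w1 w2 >].

Lemma word_eqb_refl : reflexive word_eqb.
Proof. by move=> w; apply/asboolP/word_eq_refl. Qed.

Lemma word_eqb_sym : symmetric word_eqb.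
Proof. by move=> w1 w2; apply/asboolP/asboolP; exact: word_eq_sym. Qed.

Lemma word_eqb_trans : transitive word_eqb.
Proof.
move=> w2 w1 w3 /asboolP h12 /asboolP h23; apply/asboolP.
exact: word_eq_trans h12 h23.
Qed.

Canonical word_equiv := EquivRel word_eqb
  word_eqb_refl word_eqb_sym word_eqb_trans.

Definition presented : Type := {eq_quot word_equiv}.
HB.instance Definition _ := Choice.on presented.
HB.instance Definition _ := Quotient.on presented.

Definition wordcls (w : word X) : presented := \pi_presented w.

Lemma wordclsP w1 w2 : wordcls w1 = wordcls w2 <-> word_eq rels w1 w2.
Proof.
split=> [/eqquotP/asboolP //|h].
by apply/eqquotP/asboolP.
Qed.

Lemma wordcls_repr (g : presented) : wordcls (repr g) = g.
Proof. exact: reprK. Qed.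

Lemma word_eq_catl w w1 w2 :
  word_eq rels w1 w2 -> word_eq rels (w ++ w1) (w ++ w2).
Proof.
elim=> [v|v1 v2 _|v1 v2 v3 _ h12 _ h23|v1 a v2|v1 r v2 hr].
- exact: word_eq_refl.
- exact: word_eq_sym.
- exact: word_eq_trans h12 h23.
- by rewrite !(catA w); exact: word_eq_cancel.
- by rewrite !(catA w); exact: word_eq_relator.
Qed.

Lemma word_eq_catr w w1 w2 :
  word_eq rels w1 w2 -> word_eq rels (w1 ++ w) (w2 ++ w).
Proof.
elim=> [v|v1 v2 _|v1 v2 v3 _ h12 _ h23|v1 a v2|v1 r v2 hr].
- exact: word_eq_refl.
- exact: word_eq_sym.
- exact: word_eq_trans h12 h23.
- by rewrite -!catA; exact: word_eq_cancel.
- by rewrite -!catA; exact: word_eq_relator.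
Qed.

Lemma invlK : involutive (@invl X).
Proof. by case=> x b; rewrite /invl /= negbK. Qed.

Lemma invwK : involutive (@invw X).
Proof. by move=> w; rewrite /invw map_rev revK (mapK invlK). Qed.

Lemma word_eq_invr w : word_eq rels (w ++ invw w) [::].
Proof.
elim/last_ind: w => [|w a IH]; first exact: word_eq_refl.
rewrite /invw map_rcons rev_rcons -cats1 -catA.
exact: word_eq_trans (word_eq_sym (word_eq_cancel rels w a (invw w))) IH.
Qed.

Lemma word_eq_invl w : word_eq rels (invw w ++ w) [::].
Proof. by have := word_eq_invr (invw w); rewrite invwK. Qed.

Lemma word_eq_invw w1 w2 :
  word_eq rels w1 w2 -> word_eq rels (invw w1) (invw w2).
Proof.
move=> h; apply: (@word_eq_trans _ _ _ (invw w1 ++ w2 ++ invw w2)).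
  rewrite -{1}[invw w1]cats0; apply/word_eq_catl/word_eq_sym/word_eq_invr.
rewrite catA -{2}[invw w2]cat0s; apply: word_eq_catr.
apply: (word_eq_trans _ (word_eq_invl w1)).
exact/word_eq_catl/word_eq_sym.
Qed.

Definition presented_mul (g h : presented) := wordcls (repr g ++ repr h).
Definition presented_one := wordcls [::].
Definition presented_inv (g : presented) := wordcls (invw (repr g)).

Lemma word_eq_repr w : word_eq rels (repr (wordcls w)) w.
Proof. by apply/wordclsP; rewrite wordcls_repr. Qed.

Lemma presented_mulE w1 w2 :
  presented_mul (wordcls w1) (wordcls w2) = wordcls (w1 ++ w2).
Proof.
apply/wordclsP; apply: (word_eq_trans (word_eq_catr _ (word_eq_repr w1))).
exact/word_eq_catl/word_eq_repr.
Qed.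

Lemma presented_mulA : associative presented_mul.
Proof.
move=> g h k.
by rewrite -(wordcls_repr g) -(wordcls_repr h) -(wordcls_repr k)
  !presented_mulE catA.
Qed.

Lemma presented_mul1 : left_id presented_one presented_mul.
Proof. by move=> g; rewrite -(wordcls_repr g) presented_mulE. Qed.

Lemma presented_mulr1 : right_id presented_one presented_mul.
Proof. by move=> g; rewrite -(wordcls_repr g) presented_mulE cats0. Qed.

Lemma presented_mulV :
  left_inverse presented_one presented_inv presented_mul.
Proof.
move=> g; rewrite -{2}(wordcls_repr g) presented_mulE.
exact/wordclsP/word_eq_invl.
Qed.

Lemma presented_mulrV :
  right_inverse presented_one presented_inv presented_mul.
Proof.
move=> g; rewrite -{1}(wordcls_repr g) presented_mulE.
exact/wordclsP/word_eq_invr.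
Qed.

HB.instance Definition _ := isGroup.Build presented
  presented_mulA presented_mul1 presented_mulr1
  presented_mulV presented_mulrV.

Lemma wordclsM w1 w2 : wordcls (w1 ++ w2) = (wordcls w1 * wordcls w2)%g.
Proof. by rewrite -presented_mulE. Qed.

Lemma wordcls_nil : wordcls [::] = 1%g.
Proof. by []. Qed.

Lemma wordcls_rel r : r \in rels -> wordcls r = 1%g.
Proof.
move=> hr; apply/wordclsP/word_eq_sym.
by have := word_eq_relator [::] [::] hr; rewrite /= cats0.
Qed.

Lemma wordclsV a : wordcls [:: invl a] = ((wordcls [:: a])^-1)%g.
Proof.
apply: (@mulgI _ (wordcls [:: a])); rewrite mulgV -wordclsM.
exact/wordclsP/word_eq_sym/(word_eq_cancel _ [::] a [::]).
Qed.

End Presented.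

(* The natural map <X | rels1> -> <X | rels>, which sends the element
   represented by w to the element represented by w when rels1 is contained in
   rels; see [natprojE]. *)
Definition natproj (X : choiceType) (rels1 rels : seq (word X))
  (g : presented rels1) : presented rels := wordcls rels (repr g).

Lemma word_eq_sub (X : choiceType) (rels1 rels : seq (word X)) w1 w2 :
  {subset rels1 <= rels} -> word_eq rels1 w1 w2 -> word_eq rels w1 w2.
Proof.
move=> sub; elim=> [v|v1 v2 _|v1 v2 v3 _ h12 _ h23|v1 a v2|v1 r v2 hr].
- exact: word_eq_refl.
- exact: word_eq_sym.
- exact: word_eq_trans h12 h23.
- exact: word_eq_cancel.
- exact/word_eq_relator/sub.
Qed.

Lemma natprojE (X : choiceType) (rels1 rels : seq (word X)) (w : word X) :
  {subset rels1 <= rels} -> natproj rels (wordcls rels1 w) = wordcls rels w.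
Proof. by move=> sub; apply/wordclsP/(word_eq_sub sub)/word_eq_repr. Qed.

Lemma natprojM (X : choiceType) (rels1 rels : seq (word X)) :
  {subset rels1 <= rels} ->
  {morph @natproj X rels1 rels : g h / (g * h)%g >-> (g * h)%g}.
Proof.
move=> sub g h; rewrite -(wordcls_repr g) -(wordcls_repr h) -wordclsM.
by rewrite !natprojE // wordclsM.
Qed.

(* A finite presentation of an arbitrary group G. *)
Record finpres (G : groupType) := FinPres {
  gens : finType;
  rels : seq (word gens);
  pres_map : {multiplicative presented rels -> G};
  pres_bij : bijective pres_map
}.

(* An oriented edge is a pair [(e, b)] with e an edge; it is reversed when b is
   true. *)
Notation oedge E := (E * bool)%type.
Definition orev (E : Type) (a : oedge E) : oedge E := (a.1, ~~ a.2).

Section EdgePath.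
Variables (V E : Type) (org tgt : E -> V).

Definition oorg (a : oedge E) : V := if a.2 then tgt a.1 else org a.1.
Definition otgt (a : oedge E) : V := if a.2 then org a.1 else tgt a.1.

Fixpoint edge_path (v : V) (p : seq (oedge E)) (w : V) : Prop :=
  if p is a :: p' then oorg a = v /\ edge_path (otgt a) p' w else v = w.

End EdgePath.

(* Each 2-cell f is attached along the closed edge path [bdry f] based at
   [fbase f]. *)
Record complex2 := Complex2 {
  vertex : Type;
  edge : eqType;
  face : Type;
  org : edge -> vertex;
  tgt : edge -> vertex;
  fbase : face -> vertex;
  bdry : face -> seq (oedge edge);
  bdry_closed : forall f, edge_path org tgt (fbase f) (bdry f) (fbase f)
}.

Definition edge_vertices (Y : complex2) (e : edge Y) : set (vertex Y) :=
  [set v | v = org e \/ v = tgt e].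

Definition face_vertices (Y : complex2) (f : face Y) : set (vertex Y) :=
  [set v | v = fbase f \/ exists2 a, a \in bdry f & edge_vertices a.1 v].

Record subcomplex (Y : complex2) := Subcomplex {
  sub_vertex : set (vertex Y);
  sub_edge : set (edge Y);
  sub_face : set (face Y);
  sub_edge_closed : forall e, sub_edge e -> edge_vertices e `<=` sub_vertex;
  sub_fbase_closed : forall f, sub_face f -> sub_vertex (fbase f);
  sub_bdry_closed : forall f a, sub_face f -> a \in bdry f -> sub_edge a.1
}.

Section FullSubcomplex.
Variables (Y : complex2) (A : set (vertex Y)).

Let full_edge : set (edge Y) := [set e | edge_vertices e `<=` A].
Let full_face : set (face Y) := [set f | face_vertices f `<=` A].

Let full_fbase_closed f : full_face f -> A (fbase f).
Proof. by move=> sfA; apply: sfA; left. Qed.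

Let full_bdry_closed f a : full_face f -> a \in bdry f -> full_edge a.1.
Proof. by move=> sfA fa v av; apply: sfA; right; exists a. Qed.

(* All cells of Y whose vertices lie in A. *)
Definition full_subcomplex : subcomplex Y :=
  @Subcomplex Y A full_edge full_face
    (fun _ h => h) full_fbase_closed full_bdry_closed.

End FullSubcomplex.

Section Homotopy.
Variables (Y : complex2) (S : subcomplex Y).

Definition path_in (v : vertex Y) (p : seq (oedge (edge Y))) (w : vertex Y) :
    Prop :=
  [/\ edge_path (@org Y) (@tgt Y) v p w, sub_vertex S v
    & forall a, a \in p -> sub_edge S a.1].

(* Homotopy rel endpoints of edge paths of S from v to w: the equivalence
   relation generated by inserting a backtrack, or the boundary of a 2-cell
   of S. *)
Inductive homotopic (v w : vertex Y) :
    seq (oedge (edge Y)) -> seq (oedge (edge Y)) -> Prop :=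
| homotopic_refl p : path_in v p w -> homotopic v w p p
| homotopic_sym p q : homotopic v w p q -> homotopic v w q p
| homotopic_trans p q s :
    homotopic v w p q -> homotopic v w q s -> homotopic v w p s
| homotopic_backtrack p a q :
    path_in v (p ++ q) w -> path_in v (p ++ [:: a; orev a] ++ q) w ->
    homotopic v w (p ++ q) (p ++ [:: a; orev a] ++ q)
| homotopic_face p f q : sub_face S f ->
    path_in v (p ++ q) w -> path_in v (p ++ bdry f ++ q) w ->
    homotopic v w (p ++ q) (p ++ bdry f ++ q).

(* The element of pi_0(S) given by a vertex v of S. *)
Definition pi0_class (v : vertex Y) : set (vertex Y) :=
  [set w | exists p, path_in v p w].

(* The element of the edge-path group pi_1(S, v) given by a closed path p. *)
Definition pi1_class (v : vertex Y) (p : seq (oedge (edge Y))) :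
    set (seq (oedge (edge Y))) :=
  [set q | homotopic v v p q].

End Homotopy.

Section InclusionTrivial.
Variables (Y : complex2) (S T : subcomplex Y).

(* For S included in T: the map pi_0(S) -> pi_0(T) is constant. *)
Definition pi0_trivial : Prop := forall v w : vertex Y,
  sub_vertex S v -> sub_vertex S w -> pi0_class T v = pi0_class T w.

(* For S included in T: pi_1(S, v) -> pi_1(T, v) is trivial at every base
   point v, [pi1_class T v [::]] being the neutral element. *)
Definition pi1_trivial : Prop := forall v p,
  path_in S v p v -> pi1_class T v p = pi1_class T v [::].

End InclusionTrivial.

Section Cayley.
Variables (G : groupType) (P : finpres G).

Definition gen (x : gens P) : G := pres_map P (wordcls _ [:: (x, false)]).

Let cayley_edge : choiceType := (G * gens P)%type.

Definition cayley_org (e : cayley_edge) : G := e.1.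
Definition cayley_tgt (e : cayley_edge) : G := (e.1 * gen e.2)%g.

(* The edge path starting at g and reading the word w; [(g, x, false)] goes
   from g to g * gen x. *)
Fixpoint read_word (g : G) (w : word (gens P)) : seq (oedge cayley_edge) :=
  match w with
  | [::] => [::]
  | (x, false) :: w' => ((g, x), false) :: read_word (g * gen x)%g w'
  | (x, true) :: w' =>
      ((g * (gen x)^-1, x)%g, true) :: read_word (g * (gen x)^-1)%g w'
  end.

Let cayley_face : Type := (G * {r : word (gens P) | r \in rels P})%type.
Definition cayley_fbase (f : cayley_face) : G := f.1.
Definition cayley_bdry (f : cayley_face) : seq (oedge cayley_edge) :=
  read_word f.1 (sval f.2).

Lemma pres_map1 : pres_map P 1%g = 1%g.
Proof. by apply: (@mulgI _ (pres_map P 1%g)); rewrite -gmulfM !mulg1. Qed.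

Lemma pres_mapV g : pres_map P g^-1%g = ((pres_map P g)^-1)%g.
Proof.
by apply: (@mulgI _ (pres_map P g)); rewrite -gmulfM !mulgV pres_map1.
Qed.

Lemma read_word_path g w : edge_path cayley_org cayley_tgt g (read_word g w)
  (g * pres_map P (wordcls _ w))%g.
Proof.
elim: w g => [|[x b] w IH] g /=; first by rewrite wordcls_nil pres_map1 mulg1.
rewrite -[(x, b) :: w]cat1s wordclsM gmulfM mulgA; case: b.
  rewrite (wordclsV _ (x, false)) pres_mapV.
  by split; [rewrite /oorg /cayley_tgt /= mulgVK | exact: IH].
by split=> //; exact: IH.
Qed.

Lemma cayley_bdry_closed f : edge_path cayley_org cayley_tgt
  (cayley_fbase f) (cayley_bdry f) (cayley_fbase f).
Proof.
case: f => g [r hr]; have := read_word_path g r.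
by rewrite wordcls_rel // pres_map1 mulg1.
Qed.

(* G acts by left multiplication on the first components of the cells. *)
Definition cayley_complex : complex2 := Complex2 cayley_bdry_closed.

End Cayley.

Section Sigma.
Variables (R : realType) (G : groupType).
Local Open Scope ring_scope.

Definition is_character (chi : G -> R) : Prop :=
  forall g h : G, chi (g * h)%g = chi g + chi h.

Definition nonzero (chi : G -> R) : Prop := exists g, chi g != 0.

Definition char_class (chi : G -> R) : set (G -> R) :=
  [set psi | exists2 c : R, 0 < c & psi = (fun g => c * chi g)].

Definition character_sphere : set (set (G -> R)) :=
  [set c | exists chi, [/\ is_character chi, nonzero chi & c = char_class chi]].

(* Only the values of h on the vertices enter the definition of Y^{h >= t}.
   An equivariant function on the vertex set extends continuously and
   equivariantly to the whole of Y, since G permutes the cells freely. *)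
Definition height (P : finpres G) (chi : G -> R)
    (h : vertex (cayley_complex P) -> R) : Prop :=
  forall g y : G, h (g * y)%g = chi g + h y.

Definition superlevel (P : finpres G) (h : vertex (cayley_complex P) -> R)
    (t : R) : subcomplex (cayley_complex P) :=
  full_subcomplex [set y | t <= h y].

Definition Sigma2 : set (set (G -> R)) :=
  [set c | exists chi, [/\ is_character chi, nonzero chi, c = char_class chi
    & exists (P : finpres G) (h : vertex (cayley_complex P) -> R),
        height chi h /\
        forall t : R, exists u : R, [/\ u <= t,
          pi0_trivial (superlevel h t) (superlevel h u)
        & pi1_trivial (superlevel h t) (superlevel h u)]]].

Lemma Sigma2_sub_sphere : Sigma2 `<=` character_sphere.
Proof. by move=> c [chi [chic chi0 -> _]]; exists chi. Qed.

End Sigma.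

(* Main.v *)
(* Take the finite presentation P of G given by the hypothesis and add to it
   words for the relators r in R \ R_1; this presents Q = G / N, and the Cayley
   complex of Q contains the quotient by N of the Cayley complex of G, with the
   height function descending to it. Paths lift, so the condition on pi_0 passes
   from G to Q. A loop at v in Q lifts to a path in G whose endpoints differ by
   some n in N. Write n as a product of conjugates g r^(+-1) g^-1. As g_r
   commutes with r, g may be replaced by g g_r^k, which is as high as we want
   when k is large with the right sign; the condition on pi_0 in G connects the
   base point to this high vertex by a path that does not descend far, so n is
   also realized by a path whose image in Q is a product of conjugates of
   boundaries of high 2-cells. The two paths form a loop in G, which bounds by
   the condition on pi_1. *)
From HB Require Import structures.
Require Import Defs.
From mathcomp Require Import all_boot all_order all_algebra.
From mathcomp Require Import boolp classical_sets reals.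
From mathcomp Require Import lra.

Set Implicit Arguments.
Unset Strict Implicit.
Unset Printing Implicit Defensive.

Import Order.TTheory GRing.Theory Num.Theory.

Local Open Scope classical_set_scope.
Local Open Scope ring_scope.

(** * Concatenation and reversal of edge paths *)

Definition prev_path (E : Type) (p : seq (oedge E)) : seq (oedge E) :=
  rev (map (@orev E) p).

Lemma orevK (E : Type) : involutive (@orev E).
Proof. by case=> e b; rewrite /orev /= negbK. Qed.

Section EdgePathTheory.
Variables (V E : Type) (org tgt : E -> V).

Lemma oorg_orev a : oorg org tgt (orev a) = otgt org tgt a.
Proof. by case: a => e []. Qed.

Lemma otgt_orev a : otgt org tgt (orev a) = oorg org tgt a.
Proof. by case: a => e []. Qed.

Lemma edge_path_cat v p q w : edge_path org tgt v (p ++ q) w <->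
  exists2 x, edge_path org tgt v p x & edge_path org tgt x q w.
Proof.
elim: p v => [|a p IH] v /=.
  by split=> [h|[_ -> //]]; exists v.
split=> [[va /IH[x ax xw]]|[x [va ax] xw]]; first by exists x.
by split=> //; apply/IH; exists x.
Qed.

Lemma edge_path_rev v p w :
  edge_path org tgt v p w -> edge_path org tgt w (prev_path p) v.
Proof.
elim: p v => [|a p IH] v /=; first by move=> ->.
move=> [va /IH aw]; rewrite /prev_path /= rev_cons -cats1.
apply/edge_path_cat; exists (otgt org tgt a) => //=.
by rewrite oorg_orev otgt_orev va.
Qed.

Lemma edge_path_uniq v p w w' :
  edge_path org tgt v p w -> edge_path org tgt v p w' -> w = w'.
Proof.
by elim: p v => [|a p IH] v /=; [move=> <- | move=> [_ /IH h] [_ /h]].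
Qed.

End EdgePathTheory.

(** * Homotopies rel endpoints of edge paths *)

Section HomotopyTheory.
Variables (Y : complex2) (S : subcomplex Y).
Implicit Types (v w x : vertex Y) (p q : seq (oedge (edge Y))).

Lemma path_in_nil v : sub_vertex S v -> path_in S v [::] v.
Proof. by split. Qed.

Lemma sub_edge_oedge (a : oedge (edge Y)) : sub_edge S a.1 ->
  sub_vertex S (oorg (@org Y) (@tgt Y) a) /\
  sub_vertex S (otgt (@org Y) (@tgt Y) a).
Proof.
move=> /sub_edge_closed sa.
by case: a sa => e [] sa; split; apply: sa => /=; [right|left|left|right].
Qed.

Lemma path_in_tgt v p w : path_in S v p w -> sub_vertex S w.
Proof.
case; elim: p v => [|a p IH] v /=; first by move=> <-.
move=> [va aw] _ sp; apply: (IH _ aw).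
  by apply: (proj2 (@sub_edge_oedge a _)); apply: sp; exact: mem_head.
by move=> b bp; apply: sp; rewrite in_cons bp orbT.
Qed.

Lemma path_in_cat v p q w : path_in S v (p ++ q) w <->
  exists2 x, path_in S v p x & path_in S x q w.
Proof.
split=> [[/edge_path_cat[x vx xw] sv spq]|[x [vx sv sp] [xw _ sq]]].
  have vpx : path_in S v p x.
    by split=> // a ap; apply: spq; rewrite mem_cat ap.
  exists x => //; split=> //; first exact: path_in_tgt vpx.
  by move=> a aq; apply: spq; rewrite mem_cat aq orbT.
split=> //; first by apply/edge_path_cat; exists x.
by move=> a; rewrite mem_cat => /orP[/sp|/sq].
Qed.

Lemma path_in_rev v p w : path_in S v p w -> path_in S w (prev_path p) v.
Proof.
move=> vpw; have [vw _ sp] := vpw; split; first exact: edge_path_rev.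
  exact: path_in_tgt vpw.
by move=> a; rewrite mem_rev => /mapP[b bp ->]; exact: sp bp.
Qed.

Lemma homotopic_path_in v w p q :
  homotopic S v w p q -> path_in S v p w /\ path_in S v q w.
Proof. by elim=> {p q} // [p q _ [] //|p q s _ [? _] _ [_ ?]]; split. Qed.

Lemma homotopic_cat x v w y a b p q :
    path_in S x a v -> path_in S w b y -> homotopic S v w p q ->
  homotopic S x y (a ++ p ++ b) (a ++ q ++ b).
Proof.
move=> xv wy.
have ext s : path_in S v s w -> path_in S x (a ++ s ++ b) y.
  by move=> vw; apply/path_in_cat; exists v => //; apply/path_in_cat; exists w.
elim=> {p q} [p vw|p q _ IH|p q s _ IH1 _ IH2|p e q h1 h2|p f q sf h1 h2].
- exact/homotopic_refl/ext.
- exact: homotopic_sym.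
- exact: homotopic_trans IH1 IH2.
- move: (ext _ h1) (ext _ h2); rewrite -!catA !(catA a).
  exact: homotopic_backtrack.
- move: (ext _ h1) (ext _ h2); rewrite -!catA !(catA a).
  exact: homotopic_face.
Qed.

Lemma homotopic_rev_r v p w :
  path_in S v p w -> homotopic S v v (p ++ prev_path p) [::].
Proof.
elim: p v => [|a p IH] v vpw.
  by apply/homotopic_refl/path_in_nil; case: vpw.
have := vpw; rewrite -cat1s => /path_in_cat[x va xw].
have xv := path_in_rev va.
have := homotopic_cat va xv (IH _ xw).
rewrite /prev_path /= !rev_cons -!cats1 -!catA /= => h.
apply: (homotopic_trans h); apply: homotopic_sym.
apply: (@homotopic_backtrack _ S v v [::] a [::]).
  by apply: path_in_nil; case: vpw.
by apply/(@path_in_cat _ [:: a]); exists x.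
Qed.

Lemma homotopic_rev_l v p w :
  path_in S v p w -> homotopic S w w (prev_path p ++ p) [::].
Proof.
move/path_in_rev/homotopic_rev_r.
by rewrite {2}/prev_path -map_rev revK (mapK (@orevK _)).
Qed.

Lemma homotopic_nil_cat v p q :
    homotopic S v v p [::] -> homotopic S v v q [::] ->
  homotopic S v v (p ++ q) [::].
Proof.
move=> hp hq; have [vv sv] := homotopic_path_in hq.
have := homotopic_cat sv vv hp; rewrite cat0s => h.
exact: homotopic_trans h hq.
Qed.

Lemma homotopic_nil_rev v p :
  homotopic S v v p [::] -> homotopic S v v (prev_path p) [::].
Proof.
move=> hp; have [vv sv] := homotopic_path_in hp.
have vv' := path_in_rev vv.
apply: (homotopic_trans _ (homotopic_rev_l vv)); apply: homotopic_sym.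
have := homotopic_cat vv' sv hp; rewrite !cats0.
exact.
Qed.

Lemma homotopic_face_nil f :
  sub_face S f -> homotopic S (fbase f) (fbase f) (bdry f) [::].
Proof.
move=> sf; apply: homotopic_sym.
have sv := sub_fbase_closed sf.
have := @homotopic_face _ S (fbase f) (fbase f) [::] f [::] sf.
rewrite /= cats0; apply; first exact: path_in_nil.
by split=> //; [exact: bdry_closed | move=> a; exact: sub_bdry_closed].
Qed.

End HomotopyTheory.

(** * Maps of 2-complexes carry homotopies to homotopies *)

Definition omap_edge (E E' : Type) (f : E -> E') (a : oedge E) : oedge E' :=
  (f a.1, a.2).

Section HomotopyMap.
Variables (Y Z : complex2) (S : subcomplex Y) (T : subcomplex Z).
Variables (fV : vertex Y -> vertex Z) (fE : edge Y -> edge Z).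
Variable (fF : face Y -> face Z).
Hypothesis org_fE : forall e, org (fE e) = fV (org e).
Hypothesis tgt_fE : forall e, tgt (fE e) = fV (tgt e).
Hypothesis bdry_fF : forall f, bdry (fF f) = map (omap_edge fE) (bdry f).
Hypothesis sub_fV : forall v, sub_vertex S v -> sub_vertex T (fV v).
Hypothesis sub_fE : forall e, sub_edge S e -> sub_edge T (fE e).
Hypothesis sub_fF : forall f, sub_face S f -> sub_face T (fF f).

Lemma path_in_map v p w :
  path_in S v p w -> path_in T (fV v) (map (omap_edge fE) p) (fV w).
Proof.
move=> [vw sv sp]; split; last 2 first.
- exact: sub_fV.
- by move=> b /mapP[a ap ->]; exact/sub_fE/sp.
elim: p v vw {sv sp} => [|[e b] p IH] v /=; first by move=> ->.
move=> [<- /IH]; rewrite /oorg /otgt /=.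
by case: b; rewrite org_fE tgt_fE.
Qed.

Lemma homotopic_map v w p q : homotopic S v w p q ->
  homotopic T (fV v) (fV w) (map (omap_edge fE) p) (map (omap_edge fE) q).
Proof.
elim=> {p q} [p vw|p q _ IH|p q s _ IH1 _ IH2|p e q h1 h2|p f q sf h1 h2].
- exact/homotopic_refl/path_in_map.
- exact: homotopic_sym.
- exact: homotopic_trans IH1 IH2.
- move: (path_in_map h1) (path_in_map h2); rewrite !map_cat.
  exact: homotopic_backtrack.
- move: (path_in_map h1) (path_in_map h2); rewrite !map_cat -bdry_fF.
  by apply: homotopic_face; exact: sub_fF.
Qed.

End HomotopyMap.

Lemma homotopic_sub (Y : complex2) (S T : subcomplex Y) v w p q :
    sub_vertex S `<=` sub_vertex T -> sub_edge S `<=` sub_edge T ->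
    sub_face S `<=` sub_face T ->
  homotopic S v w p q -> homotopic T v w p q.
Proof.
move=> sV sE sF; have mapid s : map (omap_edge (@id (edge Y))) s = s.
  by rewrite -[RHS]map_id; apply: eq_map => -[].
rewrite -{2}(mapid p) -{2}(mapid q).
by apply: (@homotopic_map _ _ _ _ id id id).
Qed.

(** * Classes in pi_0 and pi_1 in terms of paths and null-homotopies *)

Lemma pi0_classP (Y : complex2) (S : subcomplex Y) v w : sub_vertex S w ->
  pi0_class S v = pi0_class S w <-> exists p, path_in S v p w.
Proof.
move=> sw; split=> [vw|[p vw]].
  have : pi0_class S w w by exists [::]; exact: path_in_nil.
  by rewrite -vw.
apply/seteqP; split=> x [q qx].
  exists (prev_path p ++ q); apply/path_in_cat.
  by exists v => //; exact: path_in_rev.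
by exists (p ++ q); apply/path_in_cat; exists w.
Qed.

Lemma pi1_classP (Y : complex2) (S : subcomplex Y) v p : sub_vertex S v ->
  pi1_class S v p = pi1_class S v [::] <-> homotopic S v v p [::].
Proof.
move=> sv; split=> [vp|hp].
  have : pi1_class S v [::] [::] by exact/homotopic_refl/path_in_nil.
  by rewrite -vp.
apply/seteqP; split=> q; last exact: homotopic_trans.
exact/homotopic_trans/homotopic_sym.
Qed.

(** * Words and edge paths in a Cayley complex *)

Section ReadWord.
Variables (G : groupType) (P : finpres G).
Local Notation Y := (cayley_complex P).
Implicit Types (g : G) (w : word (gens P)).

Definition word_val w : G := pres_map P (wordcls _ w).

Definition label (p : seq (oedge (edge Y))) : word (gens P) :=
  [seq (a.1.2, a.2) | a <- p].

Lemma word_val_nil : word_val [::] = 1%g.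
Proof. exact: pres_map1. Qed.

Lemma word_val_cat w1 w2 : word_val (w1 ++ w2) = (word_val w1 * word_val w2)%g.
Proof. by rewrite /word_val wordclsM gmulfM. Qed.

Lemma word_val_inv w : word_val (invw w) = ((word_val w)^-1)%g.
Proof.
apply: (@mulgI _ (word_val w)); rewrite mulgV -word_val_cat -word_val_nil.
by congr (pres_map P _); exact/wordclsP/word_eq_invr.
Qed.

Lemma word_val_gen_inv x : word_val [:: (x, true)] = ((gen x)^-1)%g.
Proof. exact: (word_val_inv [:: (x, false)]). Qed.

Lemma word_val_surj g : exists w, word_val w = g.
Proof.
have [f _ fK] := pres_bij P; exists (repr (f g)).
by rewrite /word_val wordcls_repr.
Qed.

Lemma word_val_inj w1 w2 :
  word_val w1 = word_val w2 -> word_eq (rels P) w1 w2.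
Proof. by move/(bij_inj (pres_bij P))/wordclsP. Qed.

Lemma read_word_cat g w1 w2 :
  read_word g (w1 ++ w2) = read_word g w1 ++ read_word (g * word_val w1)%g w2.
Proof.
elim: w1 g => [|[x b] w1 IH] g /=; first by rewrite word_val_nil mulg1.
rewrite -[(x, b) :: w1]cat1s word_val_cat mulgA.
by case: b; rewrite IH ?word_val_gen_inv.
Qed.

(** A reversed path starts at the end of the original one, so the base point on the right is the
    vertex from which reading [w] leads back to [g]. *)
Lemma read_word_inv g w : read_word g (invw w) =
  prev_path (read_word (g * word_val (invw w))%g w).
Proof.
elim/last_ind: w g => [|w [x b] IH] g //.
have -> : invw (rcons w (x, b)) = [:: (x, ~~ b)] ++ invw w.
  by rewrite /invw map_rcons rev_rcons.
rewrite read_word_cat IH -mulgA -word_val_cat -cats1 read_word_cat /prev_path.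
rewrite map_cat rev_cat; congr (_ ++ _).
rewrite -mulgA -word_val_cat.
have -> : word_val (([:: (x, ~~ b)] ++ invw w) ++ w) =
    word_val [:: (x, ~~ b)].
  by rewrite -catA !word_val_cat word_val_inv mulVg mulg1.
case: b => /=; last by rewrite word_val_gen_inv.
by rewrite /orev /= -/(gen x) mulgK.
Qed.

(** Each vertex of a Cayley complex has exactly one outgoing oriented edge per letter, so a path is
    determined by its start and its label. This lets every path be handled as a word. *)
Lemma edge_path_label g p g' :
  edge_path (@org Y) (@tgt Y) g p g' -> read_word g (label p) = p.
Proof.
elim: p g => [//|[[k x] []] p IH] g /= [<- /IH e]; move: e.
  by rewrite /oorg /otgt /= /cayley_tgt /cayley_org /= mulgK => ->.
by rewrite /oorg /otgt /= /cayley_tgt /cayley_org /= => ->.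
Qed.

Lemma label_val g p g' :
  edge_path (@org Y) (@tgt Y) g p g' -> g' = (g * word_val (label p))%g.
Proof.
move=> gg'; have := read_word_path g (label p).
rewrite (edge_path_label gg'); exact: edge_path_uniq.
Qed.

End ReadWord.

Lemma path_in_read_word (G : groupType) (P : finpres G)
    (S : subcomplex (cayley_complex P)) g w g' :
  path_in S g (read_word g w) g' -> g' = (g * word_val w)%g.
Proof. by case=> gg' _ _; exact: edge_path_uniq gg' (read_word_path g w). Qed.

(** * Superlevel subcomplexes *)

Section Superlevel.
Variables (R : realType) (G : groupType) (P : finpres G).
Variables (chi : G -> R) (h : vertex (cayley_complex P) -> R).
Hypothesis h_chi : height chi h.

Lemma superlevel_edge t e : sub_edge (superlevel h t) e <->
  t <= h e.1 /\ t <= h (e.1 * gen e.2)%g.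
Proof.
split=> [te|[t1 t2]].
  by split; apply: te; [left|right].
by move=> v [] ->.
Qed.

Lemma superlevel_face t f :
    t <= h (fbase f) ->
    (forall a, a \in bdry f -> sub_edge (superlevel h t) a.1) ->
  sub_face (superlevel h t) f.
Proof. by move=> tf te; move=> v [-> //|[a /te]]; apply. Qed.

Lemma superlevel_homotopic t u v w p q : u <= t ->
  homotopic (superlevel h t) v w p q -> homotopic (superlevel h u) v w p q.
Proof.
move=> ut; have sV : [set y | t <= h y] `<=` [set y | u <= h y].
  by move=> y; exact: le_trans.
by apply: homotopic_sub => // [e|f] s; exact: (subset_trans s sV).
Qed.

Lemma superlevel_path t u v w p : u <= t ->
  path_in (superlevel h t) v p w -> path_in (superlevel h u) v p w.
Proof.
by move=> ut /homotopic_refl/(superlevel_homotopic ut)/homotopic_path_in[].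
Qed.

Lemma heightE g : h g = chi g + h 1%g.
Proof. by rewrite -(h_chi g 1%g) mulg1. Qed.

End Superlevel.

(** * Characters, and the descent of paths with respect to them *)

Lemma character1 (R : realType) (G : groupType) (chi : G -> R) :
  is_character chi -> chi 1%g = 0.
Proof. by move=> chiM; apply: (addrI (chi 1%g)); rewrite -chiM mulg1 addr0. Qed.

Lemma characterV (R : realType) (G : groupType) (chi : G -> R) g :
  is_character chi -> chi (g^-1)%g = - chi g.
Proof.
move=> chiM; apply: (addrI (chi g)).
by rewrite -chiM mulgV (character1 chiM) subrr.
Qed.

Lemma characterX (R : realType) (G : groupType) (chi : G -> R) g n :
  is_character chi -> chi (g ^+ n)%g = chi g *+ n.
Proof.
move=> chiM; elim: n => [|n IH]; first by rewrite expg0 character1.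
by rewrite expgS chiM IH mulrS.
Qed.

(** The powers of [z] commute with [b], and their characters are the multiples of [chi z], which are
    unbounded above if [chi z] is positive; otherwise [z] is replaced by its inverse. *)
Lemma commute_large (R : realType) (G : groupType) (chi : G -> R) z b M :
    is_character chi -> chi z != 0 -> commute z b ->
  exists2 y, commute y b & M <= chi y.
Proof.
move=> chiM.
wlog z0 : z / 0 < chi z => [pos|_ zb].
  rewrite neq_lt => /orP[z0|z0] zb; last by apply: (pos z); rewrite ?gt_eqF.
  apply: (pos (z^-1)%g); rewrite ?characterV // ?oppr_gt0 //.
    by rewrite oppr_eq0 lt_eqF.
  by apply/commute_sym/commuteV/commute_sym.
exists (z ^+ Num.bound `|M / chi z|%R)%g.
  by apply/commute_sym/commuteX/commute_sym.
rewrite (characterX _ _ chiM) -mulr_natl -ler_pdivrMr //.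
exact: le_trans (ler_norm _) (ltW (archi_boundP (normr_ge0 _))).
Qed.

(** Here [L] is the sum of the absolute values of [chi] over the letters of [w], which bounds the
    descent along the path. By equivariance of [h] it does not depend on the starting vertex. *)
Lemma read_word_superlevel (R : realType) (G : groupType) (P : finpres G)
    (chi : G -> R) (h : vertex (cayley_complex P) -> R) (w : word (gens P)) :
    height chi h ->
  exists2 L, 0 <= L & forall t g, t + L <= h g ->
    path_in (superlevel h t) g (read_word g w) (g * word_val w)%g.
Proof.
move=> h_chi.
elim: w => [|a w [L L0 IH]].
  exists 0 => // t g; rewrite addr0 word_val_nil mulg1 => tg.
  exact: path_in_nil.
exists (L + `|chi (word_val [:: a])|) => [|t g tg]; first by rewrite addr_ge0.
rewrite -cat1s read_word_cat word_val_cat mulgA; apply/path_in_cat.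
have chi_ge := lerNnormlW (lexx `|chi (word_val [:: a])|).
have chi_ge0 := normr_ge0 (chi (word_val [:: a])).
have hga : h (g * word_val [:: a])%g = h g + chi (word_val [:: a]).
  by rewrite h_chi (heightE h_chi (word_val _)) (heightE h_chi g); lra.
have tga : t + L <= h (g * word_val [:: a])%g by rewrite hga; lra.
have [t1 t2] : t <= h g /\ t <= h (g * word_val [:: a])%g by split; lra.
exists (g * word_val [:: a])%g; last exact: IH.
split=> //; first exact: read_word_path.
move=> e; case: a {chi_ge chi_ge0 tg hga tga} t2 => x [] /= t2.
  rewrite inE => /eqP -> /=; apply/superlevel_edge => /=.
  by rewrite mulgVK -word_val_gen_inv.
by rewrite inE => /eqP -> /=; apply/superlevel_edge.
Qed.

(** * A presentation of the quotient from one of [G] *)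

(** The kernel of [pi] lies in the normal closure of [B], put as an induction principle so that a
    property of kernel elements can be checked on conjugates of members of [B], products and
    inverses. *)
Definition kernel_generated_by (G Q : groupType) (pi : G -> Q) (B : seq G) :=
  forall K : G -> Prop, K 1%g ->
    (forall g h, K g -> K h -> K (g * h)%g) ->
    (forall g, K g -> K (g^-1)%g) ->
    (forall g b, b \in B -> K (g * b * g^-1)%g) ->
  forall n, pi n = 1%g -> K n.

Lemma multiplicative1 (G H : groupType) (f : {multiplicative G -> H}) :
  f 1%g = 1%g.
Proof. by apply: (@mulgI _ (f 1%g)); rewrite -gmulfM !mulg1. Qed.

Section QuotientPresentation.
Variables (G Q : groupType) (pi : {multiplicative G -> Q}) (B : seq G).
Variable (P : finpres G).
Hypothesis pi_surj : forall q, exists g, pi g = q.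
Hypothesis pi_B : forall b, b \in B -> pi b = 1%g.
Hypothesis pi_ker : kernel_generated_by pi B.

Definition word_of (g : G) : word (gens P) := sval (cid (word_val_surj P g)).

Lemma word_ofK g : word_val (word_of g) = g.
Proof. exact: (svalP (cid (word_val_surj P g))). Qed.

Definition quotient_rels : seq (word (gens P)) := rels P ++ map word_of B.

Definition quotient_map (g : presented quotient_rels) : Q :=
  pi (word_val (repr g)).

Lemma quotient_word_eq w1 w2 :
  word_eq quotient_rels w1 w2 -> pi (word_val w1) = pi (word_val w2).
Proof.
elim=> {w1 w2}.
- by [].
- by move=> w1 w2 _ ->.
- by move=> w1 w2 w3 _ -> _ ->.
- move=> w1 a w2; congr (pi _); rewrite /word_val; congr (pres_map P _).
  exact/wordclsP/word_eq_cancel.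
- move=> w1 r w2; rewrite mem_cat => /orP[hr|/mapP[b bB ->]].
    congr (pi _); rewrite /word_val; congr (pres_map P _).
    exact/wordclsP/word_eq_relator.
  by rewrite !word_val_cat !gmulfM word_ofK (pi_B bB) mul1g.
Qed.

Lemma quotient_map_wordcls w :
  quotient_map (wordcls quotient_rels w) = pi (word_val w).
Proof. exact/quotient_word_eq/word_eq_repr. Qed.

Lemma quotient_mapM : {morph quotient_map : g h / (g * h)%g}.
Proof.
move=> g h; rewrite -(wordcls_repr g) -(wordcls_repr h) -wordclsM.
by rewrite !quotient_map_wordcls word_val_cat gmulfM.
Qed.

HB.instance Definition _ :=
  isMultiplicative.Build (presented quotient_rels) Q quotient_map quotient_mapM.

Lemma wordcls_word_val (w1 w2 : word (gens P)) : word_val w1 = word_val w2 ->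
  wordcls quotient_rels w1 = wordcls quotient_rels w2.
Proof.
move/word_val_inj => h; apply/wordclsP; apply: word_eq_sub h => r hr.
by rewrite mem_cat hr.
Qed.

(** The map [cls] is a homomorphism from [G] to the newly presented group, because the relators of
    [P] are kept. It kills every conjugate of a member of [B], hence by [pi_ker] the whole kernel of
    [pi]. *)
Lemma quotient_map_ker g : quotient_map g = 1%g -> g = 1%g.
Proof.
rewrite -(wordcls_repr g) quotient_map_wordcls => w1.
pose cls n := wordcls quotient_rels (word_of n).
have clsM n m : cls (n * m)%g = (cls n * cls m)%g.
  by rewrite -wordclsM; apply: wordcls_word_val; rewrite word_val_cat !word_ofK.
have cls1 : cls 1%g = 1%g.
  by apply: wordcls_word_val; rewrite word_ofK word_val_nil.
have clsV n : cls (n^-1)%g = ((cls n)^-1)%g.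
  by apply/esym/mulg1_eq; rewrite -clsM mulgV.
have -> : wordcls quotient_rels (repr g) = cls (word_val (repr g)).
  by apply: wordcls_word_val; rewrite word_ofK.
move: w1; apply: (pi_ker (K := fun n => cls n = 1%g)) => //.
- by move=> n m n1 m1; rewrite clsM n1 m1 mulg1.
- by move=> n n1; rewrite clsV n1 invg1.
- move=> n b bB; rewrite !clsM clsV.
  have -> : cls b = 1%g by apply: wordcls_rel; rewrite mem_cat map_f ?orbT.
  by rewrite mulg1 mulgV.
Qed.

Lemma quotient_map_bij : bijective quotient_map.
Proof.
pose lift q := sval (cid (pi_surj q)).
pose inv q := wordcls quotient_rels (word_of (lift q)).
have invK : cancel inv quotient_map.
  by move=> q; rewrite quotient_map_wordcls word_ofK (svalP (cid (pi_surj q))).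
exists inv => // g.
have inj : injective quotient_map.
  move=> x y xy; apply/divg1_eq/quotient_map_ker.
  rewrite quotient_mapM xy -quotient_mapM mulgV quotient_map_wordcls.
  by rewrite word_val_nil multiplicative1.
by apply: inj; rewrite invK.
Qed.

Definition quotient_finpres : finpres Q :=
  @FinPres Q (gens P) quotient_rels quotient_map quotient_map_bij.

Lemma quotient_word_val (w : word (gens P)) :
  @word_val Q quotient_finpres w = pi (word_val w).
Proof. exact: quotient_map_wordcls. Qed.


(** * Projection from the complex of [G] to that of [Q], and lifting back *)

Section SigmaQuotient.
Variables (R : realType) (chi : Q -> R) (h : vertex (cayley_complex P) -> R).
Hypothesis chi_char : is_character chi.
Hypothesis h_chi : height (chi \o pi) h.

Local Notation Y := (cayley_complex P).
Local Notation Z := (cayley_complex quotient_finpres).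
Local Notation readQ := (@read_word Q quotient_finpres).

(** The constant makes [h] the composite of this height with [pi], so superlevel sets upstairs are
    the preimages of those downstairs. *)
Definition quotient_height : vertex Z -> R := fun q => chi q + h 1%g.
Local Notation k := quotient_height.

Lemma quotient_height_chi : height chi k.
Proof. by move=> q y; rewrite /k chi_char addrA. Qed.

Lemma height_proj g : h g = k (pi g).
Proof. exact: heightE h_chi g. Qed.

Definition proj_edge (e : edge Y) : edge Z := (pi e.1, e.2).

Lemma rel_quotient_rels (r : word (gens P)) :
  r \in rels P -> r \in rels quotient_finpres.
Proof. by move=> hr; rewrite mem_cat hr. Qed.

(** The image consists of the 2-cells of relators of [P]. The 2-cells of the added relators enter
    only through [nullhomotopic_wordJ]. *)
Definition proj_face (f : face Y) : face Z :=
  (pi f.1, exist _ (sval f.2) (rel_quotient_rels (svalP f.2))).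

Lemma quotient_gen (x : gens P) : @gen Q quotient_finpres x = pi (gen x).
Proof. exact: (quotient_word_val [:: (x, false)]). Qed.

Lemma map_read_word g w :
  map (omap_edge proj_edge) (read_word g w) = readQ (pi g) w.
Proof.
have piV a : pi (a^-1)%g = ((pi a)^-1)%g.
  by apply/esym/mulg1_eq; rewrite -gmulfM mulgV multiplicative1.
elim: w g => [|[x b] w IH] g //=.
by case: b => /=; rewrite IH /omap_edge /proj_edge /= gmulfM ?piV quotient_gen.
Qed.

Lemma proj_tgt e : tgt (proj_edge e) = pi (tgt e).
Proof. by rewrite /= /cayley_tgt /= quotient_gen gmulfM. Qed.

Lemma proj_edge_superlevel t e :
  sub_edge (superlevel h t) e <-> sub_edge (superlevel k t) (proj_edge e).
Proof.
split=> /superlevel_edge et; apply/superlevel_edge; move: et.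
  by rewrite !height_proj /= quotient_gen gmulfM.
by rewrite !height_proj /= quotient_gen gmulfM.
Qed.

Lemma proj_vertex_superlevel t g :
  sub_vertex (superlevel h t) g -> sub_vertex (superlevel k t) (pi g).
Proof. by rewrite /= height_proj. Qed.

Lemma proj_path t v p w : path_in (superlevel h t) v p w ->
  path_in (superlevel k t) (pi v) (map (omap_edge proj_edge) p) (pi w).
Proof.
apply: path_in_map => // [e|g|e]; first exact: proj_tgt.
  exact: proj_vertex_superlevel.
by move/proj_edge_superlevel.
Qed.

Lemma proj_homotopic t v w p q : homotopic (superlevel h t) v w p q ->
  homotopic (superlevel k t) (pi v) (pi w)
    (map (omap_edge proj_edge) p) (map (omap_edge proj_edge) q).
Proof.
apply: (@homotopic_map Y Z (superlevel h t) (superlevel k t) pi proj_edge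
  proj_face) => //.
- exact: proj_tgt.
- by move=> f /=; rewrite /cayley_bdry map_read_word.
- exact: proj_vertex_superlevel.
- by move=> e /proj_edge_superlevel.
move=> f sf; apply: superlevel_face => [|a].
  by rewrite /= /cayley_fbase /= -height_proj; exact: sub_fbase_closed sf.
rewrite /= /cayley_bdry /= -map_read_word => /mapP[b bf ->].
by apply/proj_edge_superlevel; exact: sub_bdry_closed sf bf.
Qed.

(** Corresponding vertices of the two complexes have the same height, so the lift from any preimage
    of the start stays as high. The lift of a loop need not close up. *)
Lemma lift_path t g (w : word (gens P)) q :
  path_in (superlevel k t) (pi g) (readQ (pi g) w) q ->
  path_in (superlevel h t) g (read_word g w) (g * word_val w)%g.
Proof.
case=> _ tg sp; split; first exact: read_word_path.
  by rewrite /= height_proj.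
move=> a ag; apply/proj_edge_superlevel; apply: (sp (omap_edge proj_edge a)).
by rewrite -map_read_word map_f.
Qed.

(* The paths live in the complex of Q, but [n] is an element of G: the lifts of
   the loop read by [w] join the vertices x and x n. *)
Definition nullhomotopic_word (t u : R) (n : G) : Prop :=
  forall q : Q, t <= k q -> exists2 w : word (gens P), word_val w = n &
    homotopic (superlevel k u) q q (readQ q w) [::].

Lemma nullhomotopic_word1 t u : u <= t -> nullhomotopic_word t u 1%g.
Proof.
move=> ut q tq; exists [::]; first exact: word_val_nil.
by apply/homotopic_refl/path_in_nil; exact: le_trans tq.
Qed.

Lemma nullhomotopic_wordM t u n m : nullhomotopic_word t u n ->
  nullhomotopic_word t u m -> nullhomotopic_word t u (n * m)%g.
Proof.
move=> hn hm q tq; have [w <- hw] := hn q tq; have [s <- hs] := hm q tq.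
exists (w ++ s); first by rewrite word_val_cat.
rewrite (@read_word_cat Q quotient_finpres).
(* The loop read by [w] returns to [q], so [s] is read from [q] as well. *)
have /path_in_read_word <- := (homotopic_path_in hw).1.
exact: homotopic_nil_cat.
Qed.

Lemma nullhomotopic_read_word_inv u q w :
  homotopic (superlevel k u) q q (readQ q w) [::] ->
  homotopic (superlevel k u) q q (readQ q (invw w)) [::].
Proof.
move=> hw; have qw := path_in_read_word (homotopic_path_in hw).1.
have qV : (q * (@word_val Q quotient_finpres w)^-1)%g = q.
  by rewrite {1}qw mulgK.
rewrite read_word_inv word_val_inv qV.
exact: homotopic_nil_rev.
Qed.

Lemma nullhomotopic_wordV t u n :
  nullhomotopic_word t u n -> nullhomotopic_word t u (n^-1)%g.
Proof.
move=> hn q tq; have [w <- hw] := hn q tq.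
exists (invw w); first exact: word_val_inv.
exact: nullhomotopic_read_word_inv.
Qed.

(* [g] is replaced by [g * y] with [y] a high power of [z] or [z^-1], so that
   the 2-cell of [b] at the end of the path is above level t. *)
Lemma nullhomotopic_wordJ t u g b z : u <= t ->
    pi0_trivial (superlevel h t) (superlevel h u) ->
    b \in B -> chi (pi z) != 0 -> commute z b ->
  nullhomotopic_word t u (g * b * g^-1)%g.
Proof.
move=> ut pi0t bB z0 zb q tq; have [x xq] := pi_surj q.
have [L L0 rdL] := @read_word_superlevel R Q quotient_finpres chi k (word_of b)
  quotient_height_chi.
have chi_pi : is_character (chi \o pi).
  by move=> m n /=; rewrite gmulfM chi_char.
(* The bound on [y] puts [x * g * y] at height at least t + L, where [L] is the greatest possible
   descent along the boundary of the 2-cell of [b]. *)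
have [y yb My] := commute_large (t + L - h (x * g)%g) chi_pi z0 zb.
have hxgy : h (x * g * y)%g = chi (pi y) + h (x * g)%g.
  rewrite (heightE h_chi (x * g * y)%g) (heightE h_chi (x * g)%g) /=.
  rewrite gmulfM chi_char; by lra.
have tLy : t + L <= h (x * g * y)%g by rewrite hxgy; move: My => /=; lra.
have tx : t <= h x by rewrite height_proj xq.
have ty : t <= h (x * g * y)%g by lra.
(* Both [x] and [x * g * y] lie above t, so a path above u joins them in the complex of [G]; its
   label [s] then represents [g * y]. *)
have /pi0_classP[|p xp] := pi0t _ _ tx ty; first exact: le_trans ut ty.
pose s := label p.
have [xp_path _ _] := xp.
have s_val : word_val s = (g * y)%g.
  by apply: (@mulgI _ x); rewrite -(label_val xp_path) mulgA.
pose q' := pi (x * g * y)%g.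
have qs : (q * @word_val Q quotient_finpres s)%g = q'.
  by rewrite quotient_word_val // s_val -xq -gmulfM mulgA.
have path_s : path_in (superlevel k u) q (readQ q s) q'.
  by rewrite -xq -map_read_word (edge_path_label xp_path); exact: proj_path.
have q'b : (q' * @word_val Q quotient_finpres (word_of b))%g = q'.
  by rewrite quotient_word_val // word_ofK pi_B // mulg1.
have loop_b : homotopic (superlevel k u) q' q' (readQ q' (word_of b)) [::].
  have rb : word_of b \in rels quotient_finpres by rewrite mem_cat map_f ?orbT.
  apply: (@homotopic_face_nil Z (superlevel k u) (q', exist _ (word_of b) rb)).
  have tLq' : t + L <= k q' by rewrite -height_proj.
  have [_ tq' sb] := superlevel_path ut (rdL _ _ tLq').
  exact: superlevel_face.
(* This word represents g y b y^-1 g^-1, which is g b g^-1 because [y] commutes with [b]. *)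
exists (s ++ word_of b ++ invw s).
  rewrite !word_val_cat word_val_inv s_val word_ofK invgM.
  by rewrite -(mulgA g y) (mulgA y b) yb -!mulgA mulVKg.
have readV : readQ q' (invw s) = prev_path (readQ q s).
  rewrite (@read_word_inv Q quotient_finpres) word_val_inv.
  by rewrite -[in LHS]qs mulgK.
rewrite !(@read_word_cat Q quotient_finpres) qs q'b readV.
apply: homotopic_trans (homotopic_rev_r path_s).
exact: homotopic_cat path_s (path_in_rev path_s) loop_b.
Qed.

Lemma quotient_superlevel_trivial t :
    (forall b, b \in B -> exists2 z, chi (pi z) != 0 & commute z b) ->
    (forall t, exists u, [/\ u <= t,
        pi0_trivial (superlevel h t) (superlevel h u)
      & pi1_trivial (superlevel h t) (superlevel h u)]) ->
  exists u, [/\ u <= t,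
      pi0_trivial (superlevel k t) (superlevel k u)
    & pi1_trivial (superlevel k t) (superlevel k u)].
Proof.
move=> comm_B sigma_h.
(* Two descents: to [u1] for joining vertices, which yields the correcting loop, and from there to
   [u2] for filling the corrected loop in [G]. *)
have [u1 [u1t pi0_1 _]] := sigma_h t; have [u2 [u21 _ pi1_2]] := sigma_h u1.
exists u2; split=> [|v w tv tw|v p tp]; first exact: le_trans u1t.
  have [x xv] := pi_surj v; have [y yw] := pi_surj w.
  have tx : t <= h x by rewrite height_proj xv.
  have ty : t <= h y by rewrite height_proj yw.
  have /pi0_classP[|p xp] := pi0_1 _ _ tx ty; first exact: le_trans u1t ty.
  apply/pi0_classP; first exact: le_trans (le_trans u21 u1t) tw.
  exists (map (omap_edge proj_edge) p); apply: (superlevel_path u21).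
  by rewrite -xv -yw; exact: proj_path.
have [vp_path tv _] := tp.
have [x xv] := pi_surj v.
pose w : word (gens P) := label p.
have pw : readQ v w = p by exact: edge_path_label vp_path.
have ker_w : pi (word_val w) = 1%g.
  rewrite -quotient_word_val //; apply: (@mulgI _ v); rewrite mulg1.
  exact/esym/label_val.
have null_w : nullhomotopic_word t u1 (word_val w).
  apply: (pi_ker (K := nullhomotopic_word t u1)) => //.
  - exact: nullhomotopic_word1.
  - by move=> g g' ng ng'; exact: nullhomotopic_wordM.
  - by move=> g ng; exact: nullhomotopic_wordV.
  - move=> g b bB; have [z z0 zb] := comm_B b bB.
    exact: nullhomotopic_wordJ z0 zb.
(* The words [s] and [w] represent the same element of [G], and [s] reads a null-homotopic loop at
   [v]. Hence the loop of [w ++ invw s] at [v] lifts to a closed path at [x]. *)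
have [s sw null_s] := null_w v tv.
have null_sV := nullhomotopic_read_word_inv null_s.
have [path_sV u1v] := homotopic_path_in null_sV.
have path_p : path_in (superlevel k u1) v (readQ v (w ++ invw s)) v.
  rewrite (@read_word_cat Q quotient_finpres) pw -(label_val vp_path).
  by apply/path_in_cat; exists v => //; exact: superlevel_path tp.
have : path_in (superlevel h u1) x (read_word x (w ++ invw s)) x.
  rewrite -{3}(mulg1 x) -(mulgV (word_val w)) -{2}sw -word_val_inv.
  by rewrite -word_val_cat; apply: (@lift_path u1 x _ v); rewrite xv.
(* The lifted loop is contracted above [u2] in the complex of [G], and the contraction is projected
   to that of [Q]. *)
move=> /pi1_2/pi1_classP => /(_ _)/proj_homotopic.
rewrite map_read_word xv (@read_word_cat Q quotient_finpres) pw.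
rewrite -(label_val vp_path) => null_p.
have u2v : sub_vertex (superlevel k u2) v.
  exact: le_trans (le_trans u21 u1t) tv.
apply/pi1_classP => //; apply: (homotopic_trans _ (null_p _)); last first.
  by rewrite /= height_proj xv.
(* It remains to see that [p] is homotopic to [p] followed by the null-homotopic loop of
   [invw s]. *)
have path_pu2 := superlevel_path (le_trans u21 u1t) tp.
have := homotopic_cat path_pu2 (path_in_nil u2v)
  (superlevel_homotopic u21 null_sV).
by rewrite !cats0 => /homotopic_sym.
Qed.

End SigmaQuotient.

End QuotientPresentation.

(** * The kernel of the natural surjection, and the conclusion *)

Lemma natproj_ker (X : choiceType) (rels rels1 : seq (word X)) :
    {subset rels1 <= rels} ->
  kernel_generated_by (@natproj X rels1 rels)
    [seq wordcls rels1 r | r <- rels & r \notin rels1].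
Proof.
move=> sub K K1 KM KV KJ n.
rewrite -(wordcls_repr n) natprojE // -(wordcls_nil rels) => /wordclsP.
(* Stated for pairs of words, the claim goes by induction on equality in the larger presentation.
   Only a relator r outside [rels1] changes the element of [G]: the quotient of w1 w2 by w1 r w2 is
   w1 r^-1 w1^-1, the inverse of a conjugate of r. *)
suff KE w1 w2 : word_eq rels w1 w2 ->
    K (wordcls rels1 w1 * (wordcls rels1 w2)^-1)%g.
  by move=> /KE; rewrite wordcls_nil invg1 mulg1.
elim=> {w1 w2} [w|w1 w2 _ /KV|w1 w2 w3 _ K12 _ K23|w1 a w2|w1 r w2 hr].
- by rewrite mulgV.
- by rewrite invgM invgK.
- by have := KM _ _ K12 K23; rewrite mulgA mulgVK.
- have -> : wordcls rels1 (w1 ++ w2) =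
      wordcls rels1 (w1 ++ [:: a; invl a] ++ w2).
    exact/wordclsP/word_eq_cancel.
  by rewrite mulgV.
have [r1|r1] := boolP (r \in rels1).
  have -> : wordcls rels1 (w1 ++ w2) = wordcls rels1 (w1 ++ r ++ w2).
    exact/wordclsP/word_eq_relator.
  by rewrite mulgV.
have rB :
    wordcls rels1 r \in [seq wordcls rels1 r | r <- rels & r \notin rels1].
  by apply: map_f; rewrite mem_filter r1.
have /KV := KJ (wordcls rels1 w1) _ rB.
by rewrite !wordclsM !invgM !invgK !mulgA mulgK.
Qed.

Lemma char_class_scale (R : realType) (G : groupType) (chi : G -> R) c :
  0 < c -> char_class (fun g => c * chi g) = char_class chi.
Proof.
move=> c0; apply/seteqP; split=> psi [d d0 ->].
  exists (d * c); first exact: mulr_gt0.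
  by apply/funext => g; rewrite mulrA.
exists (d / c); first exact: divr_gt0.
by apply/funext => g; rewrite mulrA divfK ?gt_eqF.
Qed.

Theorem theorem5p4 (R : realType) (X : finType) (rels rels1 : seq (word X))
    (sub : {subset rels1 <= rels})
    (chi : presented rels -> R) (chi_char : is_character chi)
    (chiG_Sigma2 : Sigma2 (char_class (chi \o @natproj X rels1 rels)))
    (comm_rel : forall r : word X, r \in rels -> r \notin rels1 ->
       exists g : presented rels1,
         chi (natproj rels g) != 0 /\ commute g (wordcls rels1 r)) :
  Sigma2 (char_class chi).
Proof.
pose pi : {multiplicative presented rels1 -> presented rels} :=
  HB.pack (@natproj X rels1 rels)
    (isMultiplicative.Build _ _ _ (@natprojM X rels1 rels sub)).
have [psi [_ psi0 psiE [P [h [h_psi sigma_h]]]]] := chiG_Sigma2.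
(* The hypothesis supplies [P] and [h] for some representative [psi] of the class. As [psi] lies in
   its own class, it is a positive multiple [c] of the character induced by [chi], so [chi] is
   replaced by [chic], which has the same class and induces [psi]. *)
have : char_class psi psi.
  by exists 1 => //; apply/funext => g; rewrite mul1r.
rewrite -psiE => -[c c0 psi_chi].
pose chic : presented rels -> R := fun q => c * chi q.
have chic_char : is_character chic.
  by move=> g g'; rewrite /chic chi_char mulrDr.
have chic0 : nonzero chic.
  by have [g] := psi0; rewrite psi_chi; exists (natproj rels g).
have pi_surj q : exists g, pi g = q.
  by exists (wordcls rels1 (repr q)); rewrite /= natprojE // wordcls_repr.
pose B := [seq wordcls rels1 r | r <- rels & r \notin rels1].
have pi_B b : b \in B -> pi b = 1%g.
  case/mapP => r; rewrite mem_filter => /andP[_ hr] ->.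
  by rewrite /= natprojE // wordcls_rel.
have comm_B b : b \in B -> exists2 z, chic (pi z) != 0 & commute z b.
  case/mapP => r; rewrite mem_filter => /andP[r1 hr] ->.
  have [z [z0 zr]] := comm_rel r hr r1; exists z => //.
  by rewrite mulf_neq0 // gt_eqF.
rewrite -(char_class_scale chi c0).
exists chic; split=> //.
have h_chic : height (chic \o pi) h by move=> g y; rewrite h_psi psi_chi.
have pi_ker : kernel_generated_by pi B := natproj_ker sub.
exists (@quotient_finpres _ _ pi B P pi_surj pi_B pi_ker).
exists (@quotient_height _ _ pi B P pi_surj pi_B pi_ker R chic h).
split; first exact: quotient_height_chi.
by move=> t; exact: (quotient_superlevel_trivial _ _ _ _ h_chic).
Qed.
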